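(* Let $\Phi$ be an $M\times N$ Steiner equiangular tight frame. Then for every $\delta>0$, $\Phi$ has the $(K,\delta)$-restricted isometry property for every positive integer $K\leq\delta\sqrt{M}$; but for every $\varepsilon>0$, $\Phi$ does not have the $(K,1-\varepsilon)$-restricted isometry property for any integer $K>\sqrt{2M}$.
   Context: A matrix $\Phi$ with $N$ columns has the $(K,\delta)$-restricted isometry property if $(1-\delta)\|x\|^2\le\|\Phi x\|^2\le(1+\delta)\|x\|^2$ for every vector $x$ with $N$ entries, at most $K$ of which are nonzero ($\|\cdot\|$ is the Euclidean norm). A $(2,k,v)$-Steiner system ($2\le k\le v$) is a $v$-element set $V$ with a collection of size-$k$ subsets (blocks) such that every $2$-element subset of $V$ lies in exactly one block; then each point lies in $\frac{v-1}{k-1}$ blocks and there are $\frac{v(v-1)}{k(k-1)}$ blocks. Its incidence matrix $A$ has rows indexed by points, columns indexed by blocks, and entry $1$ if the point lies in the block and $0$ otherwise. A Steiner equiangular tight frame is any matrix $\Phi$ of size $M\times N$, with $M=\frac{v(v-1)}{k(k-1)}$ and $N=v(1+\frac{v-1}{k-1})$, built from a $(2,k,v)$-Steiner system as follows. For each $j=1,\dots,v$ let $H_j$ be any square matrix of size $1+\frac{v-1}{k-1}$ with unimodular entries and orthogonal rows; let $\Phi_j$ be the $M\times(1+\frac{v-1}{k-1})$ matrix obtained from the $j$th column of $A^{\mathrm T}$ by replacing each entry $1$ with a distinct row of $H_j$ and each entry $0$ with a row of zeros; and set $\Phi=\left(\frac{k-1}{v-1}\right)^{1/2}[\Phi_1\cdots\Phi_v]$.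 *)

(* Defs.v *)
From HB Require Import structures.
From mathcomp Require Import all_boot all_order all_algebra spectral.
From mathcomp Require Import complex reals.

Set Implicit Arguments.
Unset Strict Implicit.
Unset Printing Implicit Defensive.

Import Order.TTheory GRing.Theory Num.Theory.
Local Open Scope ring_scope.
Local Open Scope complex_scope.

(* The norm of the library on R[i] takes values in R[i]; its real part is the
   usual modulus. *)
Definition modulus (R : realType) (z : R[i]) : R := complex.Re `|z|.

Definition l2norm (R : realType) (n : nat) (x : 'cV[R[i]]_n) : R :=
  Num.sqrt (\sum_i modulus (x i 0) ^+ 2).

Definition restricted_isometry (R : realType) (M N : nat)
    (Phi : 'M[R[i]]_(M, N)) (K : nat) (delta : R) : Prop :=
  forall x : 'cV[R[i]]_N, (#|[set i | x i 0%R != 0%R]| <= K)%N ->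
    (1 - delta) * l2norm x ^+ 2 <= l2norm (Phi *m x) ^+ 2
      /\ l2norm (Phi *m x) ^+ 2 <= (1 + delta) * l2norm x ^+ 2.

Record steiner_system (k v : nat) (V : finType) (blocks : {set {set V}}) :
    Prop := SteinerSystem {
  steiner_k_ge2 : (2 <= k)%N;
  steiner_k_le_v : (k <= v)%N;
  steiner_points : #|V| = v;
  steiner_block_size : forall b : {set V}, b \in blocks -> #|b| = k;
  steiner_pair : forall p : {set V}, #|p| = 2%N ->
    #|[set b in blocks | p \subset b]| = 1%N
}.

(* These quotients are exact for the parameters of a Steiner system. *)
Definition replication (k v : nat) : nat := ((v - 1) %/ (k - 1))%N.
Definition num_blocks (k v : nat) : nat := ((v * (v - 1)) %/ (k * (k - 1)))%N.

(* Rows and columns follow the enumerations pt and blk of points and blocks. *)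
Definition incidence_mx (C : pzSemiRingType) (V : finType) (v b : nat)
    (pt : 'I_v -> V) (blk : 'I_b -> {set V}) : 'M[C]_(v, b) :=
  \matrix_(i, j) (pt i \in blk j)%:R.

Definition unimodular_orthogonal (R : realType) (n : nat) (H : 'M[R[i]]_n) :
    Prop :=
  (forall i j, modulus (H i j) = 1)
  /\ (forall i j, i != j -> dotmx (row i H) (row j H) = 0).

(* The entry 1 in position i of the column a is replaced with row sel i of H;
   the values of sel elsewhere are irrelevant. *)
Definition replace_ones (C : nzRingType) (M n : nat) (a : 'cV[C]_M)
    (H : 'M[C]_n) (sel : 'I_M -> 'I_n) : 'M[C]_(M, n) :=
  \matrix_(i < M) (if a i 0%R == 1 then row (sel i) H else 0).

(* The sum in eN, which is the width of the row of v blocks, is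
   v * (1 + replication k v). *)
Variant steiner_etf (R : realType) (M N : nat) (Phi : 'M[R[i]]_(M, N)) : Prop :=
  SteinerETF (k v : nat) (V : finType) (blocks : {set {set V}})
    (pt : 'I_v -> V) (blk : 'I_M -> {set V})
    (H : 'I_v -> 'M[R[i]]_(1 + replication k v))
    (sel : 'I_v -> 'I_M -> 'I_(1 + replication k v))
    (A := incidence_mx R[i] pt blk)
    (eN : (\sum_(j < v) (1 + replication k v))%N = N) of
    steiner_system k v blocks &
    M = num_blocks k v &
    bijective pt &
    injective blk &
    [set blk b | b : 'I_M] = blocks &
    (forall j, unimodular_orthogonal (H j)) &
    (forall j b b', A^T b j = 1 -> A^T b' j = 1 ->
      sel j b = sel j b' -> b = b') &
    Phi = castmx (erefl M, eN)
      ((Num.sqrt ((k%:R - 1) / (v%:R - 1)) : R)%:C *: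
        \mxrow_(j < v) replace_ones (col j A^T) (H j) (sel j)).

(* Main.v *)
Require Import Defs.
From mathcomp Require Import all_boot all_order all_algebra.
From mathcomp Require Import complex reals.
From mathcomp Require Import spectral ring lra zify.

(** Write r = (v - 1) / (k - 1) for the number of blocks through a point.
    Counting gives M k = v r, and two facts about the columns of a Steiner
    equiangular tight frame then decide the range of the restricted isometry
    property.

    Every column has unit norm, and two distinct columns have an inner product
    of modulus exactly 1 / r. For columns attached to different points, only
    the unique block through both points contributes to the inner product. For
    columns attached to the same point j, the inner product runs over r of the
    r + 1 rows of H_j; since the columns of H_j are orthogonal, it is minus the
    unimodular contribution of the one row that is left out
    ([mxrow_spread_coherence]). A matrix with unit columns of coherence mu
    distorts the squared norm of a K-sparse vector by at most (K - 1) mu, by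
    the Cauchy-Schwarz inequality ([coherence_restricted_isometry]). As k <= v
    forces M <= r^2, the condition K <= delta sqrt M gives K / r <= delta.

    The r + 1 columns attached to one point have rank at most r, because they
    have only r nonzero rows: the conjugate of the row of H_j that is left out
    is orthogonal to all of them, so the frame kills a nonzero vector with at
    most r + 1 nonzero entries ([mxrow_spread_kernel]). As k >= 2 forces
    2 M >= r (r + 1), an integer K > sqrt (2 M) is at least r + 1, and the
    lower bound of the isometry property fails on this vector. *)

Set Implicit Arguments.
Unset Strict Implicit.
Unset Printing Implicit Defensive.

Import Order.TTheory GRing.Theory Num.Theory.
Local Open Scope ring_scope.
Local Open Scope complex_scope.

(** * The modulus and the Euclidean norm *)

Lemma modulusE (R : realType) (z : R[i]) : (modulus z)%:C = `|z|.
Proof. by rewrite /modulus normc_def. Qed.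

Lemma modulus_ge0 (R : realType) (z : R[i]) : 0 <= modulus z.
Proof. by rewrite -ler0c modulusE. Qed.

Lemma modulusM (R : realType) (z w : R[i]) :
  modulus (z * w) = modulus z * modulus w.
Proof. by apply: complexI; rewrite rmorphM !modulusE normrM. Qed.

Lemma modulus_conj (R : realType) (z : R[i]) :
  modulus (Num.conj z) = modulus z.
Proof. by apply: complexI; rewrite !modulusE norm_conjC. Qed.

Lemma modulusN (R : realType) (z : R[i]) : modulus (- z) = modulus z.
Proof. by apply: complexI; rewrite !modulusE normrN. Qed.

Lemma modulus_real (R : realType) (a : R) : modulus a%:C = `|a|.
Proof. by rewrite /modulus normc_def /= expr0n addr0 sqrtr_sqr. Qed.

Lemma modulus0 (R : realType) : modulus (0 : R[i]) = 0.
Proof. by rewrite -(rmorph0 (real_complex R)) modulus_real normr0. Qed.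

Lemma modulus_eq0 (R : realType) (z : R[i]) : (modulus z == 0) = (z == 0).
Proof. by rewrite -(inj_eq (@complexI R)) modulusE normr_eq0. Qed.

Lemma modulus_sqrE (R : realType) (z : R[i]) :
  (modulus z ^+ 2)%:C = z * Num.conj z.
Proof. by rewrite rmorphXn /= modulusE normCK. Qed.

Lemma modulus_sum (R : realType) (I : finType) (P : pred I) (F : I -> R[i]) :
  modulus (\sum_(i | P i) F i) <= \sum_(i | P i) modulus (F i).
Proof.
by rewrite -lecR modulusE raddf_sum; exact: ler_norm_sum.
Qed.

Lemma l2norm_sqr (R : realType) (n : nat) (x : 'cV[R[i]]_n) :
  l2norm x ^+ 2 = \sum_i modulus (x i 0) ^+ 2.
Proof. by rewrite sqr_sqrtr // sumr_ge0 // => i _; rewrite sqr_ge0. Qed.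

(** * Coherence and the restricted isometry property *)

(** Cauchy-Schwarz against the constant 1 on A, read off from the sum of all
    (a i - a j)^2, which is twice the difference of the two sides. *)
Lemma sqr_sum_le_card (R : realFieldType) (I : finType) (A : {set I})
    (a : I -> R) :
  (\sum_(i in A) a i) ^+ 2 <= #|A|%:R * \sum_(i in A) a i ^+ 2.
Proof.
have : 0 <= \sum_(i in A) \sum_(j in A) (a i - a j) ^+ 2.
  by apply: sumr_ge0 => i _; apply: sumr_ge0 => j _; exact: sqr_ge0.
have -> : \sum_(i in A) \sum_(j in A) (a i - a j) ^+ 2 =
    2 * (#|A|%:R * (\sum_(i in A) a i ^+ 2) - (\sum_(i in A) a i) ^+ 2).
  transitivity (\sum_(i in A) (#|A|%:R * a i ^+ 2
      - 2 * a i * (\sum_(j in A) a j) + \sum_(j in A) a j ^+ 2)).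
    apply: eq_bigr => i _; rewrite mulr_sumr mulr_natl -sumr_const -sumrB.
    by rewrite -big_split; apply: eq_bigr => j _ /=; ring.
  rewrite big_split sumrB /= -mulr_sumr -mulr_suml -mulr_sumr sumr_const.
  by rewrite -mulr_natl; ring.
by lra.
Qed.

(** The squared norm of Phi x is the Hermitian form of the Gram matrix of the
    columns of Phi, so it can be bounded entry by entry. *)
Lemma l2norm_sqr_mulmx (R : realType) (M N : nat) (Phi : 'M[R[i]]_(M, N))
    (x : 'cV[R[i]]_N) :
  (l2norm (Phi *m x) ^+ 2)%:C =
  \sum_c \sum_c' x c 0 * Num.conj (x c' 0) *
    \sum_b Phi b c * Num.conj (Phi b c').
Proof.
rewrite l2norm_sqr raddf_sum.
under eq_bigr => b _.
  rewrite /= modulus_sqrE mxE rmorph_sum mulr_suml.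
  under eq_bigr => c _ do rewrite mulr_sumr.
  over.
rewrite exchange_big; apply: eq_bigr => c _.
rewrite exchange_big; apply: eq_bigr => c' _.
by rewrite mulr_sumr; apply: eq_bigr => b _; rewrite rmorphM /=; ring.
Qed.

(** The diagonal of the Gram matrix contributes the squared norm of x. The
    off-diagonal part is at most mu times the sum of |x_c| |x_c'| over
    c <> c', that is, mu ((sum |x_c|)^2 - sum |x_c|^2), and a K-sparse x has
    (sum |x_c|)^2 <= K sum |x_c|^2. *)
Lemma coherence_restricted_isometry (R : realType) (M N : nat)
    (Phi : 'M[R[i]]_(M, N)) (mu : R) (K : nat) (delta : R) :
  0 <= mu ->
  (forall c, \sum_b modulus (Phi b c) ^+ 2 = 1) ->
  (forall c c', c != c' ->
     modulus (\sum_b Phi b c * Num.conj (Phi b c')) <= mu) ->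
  (K%:R - 1) * mu <= delta ->
  restricted_isometry Phi K delta.
Proof.
move=> mu0 unit_col coh Kmu x supp_x.
set m := fun c => modulus (x c 0).
have nx : l2norm x ^+ 2 = \sum_c m c ^+ 2 by rewrite l2norm_sqr.
have off : \sum_c \sum_(c' | c' != c) m c * m c' <=
    (K%:R - 1) * \sum_c m c ^+ 2.
  have -> : \sum_c \sum_(c' | c' != c) m c * m c' =
      (\sum_c m c) ^+ 2 - \sum_c m c ^+ 2.
    rewrite expr2 mulr_suml -sumrB; apply: eq_bigr => c _.
    by rewrite mulr_sumr [in RHS](bigD1 c) //= expr2 [RHS]addrAC subrr add0r.
  rewrite mulrBl mul1r lerD2r.
  set A := [set i | x i 0 != 0] in supp_x.
  have outA c : c \notin A -> m c = 0.
    by rewrite inE negbK => /eqP xc; rewrite /m xc modulus0.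
  rewrite (bigID (mem A)) /= [X in _ + X]big1 ?addr0 => [|c /outA //].
  rewrite [X in _ <= _ * X](bigID (mem A)) /= [X in _ <= _ * (_ + X)]big1;
    last by move=> c /outA ->; rewrite expr0n.
  rewrite addr0 (le_trans (sqr_sum_le_card _ _)) //.
  apply: ler_wpM2r; first by apply: sumr_ge0 => c _; exact: sqr_ge0.
  by rewrite ler_nat.
have dev : `|l2norm (Phi *m x) ^+ 2 - l2norm x ^+ 2| <=
    mu * \sum_c \sum_(c' | c' != c) m c * m c'.
  rewrite -modulus_real rmorphB /= l2norm_sqr_mulmx nx raddf_sum -sumrB.
  have -> : \sum_c (\sum_c' x c 0 * Num.conj (x c' 0) *
        (\sum_b Phi b c * Num.conj (Phi b c')) - (m c ^+ 2)%:C) =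
      \sum_c \sum_(c' | c' != c) x c 0 * Num.conj (x c' 0) *
        \sum_b Phi b c * Num.conj (Phi b c').
    apply: eq_bigr => c _; rewrite (bigD1 c) //=.
    have -> : \sum_b Phi b c * Num.conj (Phi b c) = 1.
      under eq_bigr do rewrite -modulus_sqrE.
      by rewrite -raddf_sum unit_col.
    by rewrite mulr1 -modulus_sqrE [LHS]addrAC subrr add0r.
  apply: le_trans (modulus_sum _ _) _; rewrite mulr_sumr.
  apply: ler_sum => c _.
  apply: le_trans (modulus_sum _ _) _; rewrite mulr_sumr.
  apply: ler_sum => c' c'c; rewrite !modulusM modulus_conj mulrC.
  by apply: ler_wpM2r; rewrite ?mulr_ge0 ?modulus_ge0 // coh // eq_sym.
have s0 : 0 <= \sum_c m c ^+ 2 by apply: sumr_ge0 => c _; exact: sqr_ge0.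
have {dev off} : `|l2norm (Phi *m x) ^+ 2 - l2norm x ^+ 2| <=
    delta * l2norm x ^+ 2.
  rewrite (le_trans dev) // nx (le_trans (ler_wpM2l mu0 off)) //.
  by rewrite mulrA [mu * _]mulrC ler_wpM2r.
by rewrite ler_norml => /andP[lo hi]; split; lra.
Qed.

Lemma sparse_kernel_not_restricted_isometry (R : realType) (M N : nat)
    (Phi : 'M[R[i]]_(M, N)) (K : nat) (epsilon : R) (x : 'cV[R[i]]_N) :
  0 < epsilon -> x != 0 -> Phi *m x = 0 ->
  (#|[set i | x i 0%R != 0%R]| <= K)%N ->
  ~ restricted_isometry Phi K (1 - epsilon).
Proof.
move=> e0 x0 ker supp_x /(_ x supp_x) [+ _].
have -> : l2norm (Phi *m x) ^+ 2 = 0.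
  by rewrite ker l2norm_sqr big1 // => i _; rewrite mxE modulus0 expr0n.
have /cV0Pn[c xc] : x != 0 by [].
rewrite opprB addrC subrK leNgt mulr_gt0 // l2norm_sqr (bigD1 c) //=.
rewrite ltr_pwDl ?sumr_ge0 // => [|i _]; rewrite ?sqr_ge0 //.
by rewrite lt_def sqrf_eq0 modulus_eq0 xc sqr_ge0.
Qed.

(** * Counting blocks *)

Lemma card_set_sum (T : finType) (P : pred T) :
  #|[set x | P x]| = (\sum_x P x)%N.
Proof.
rewrite cardsE -sum1_card big_mkcond; apply: eq_bigr => x _.
by rewrite unfold_in; case: (P x).
Qed.

(** Count the pairs of a block b through p and a point q <> p of b: each of the
    blocks through p holds k - 1 such points, and each point q lies with p on
    one block. *)
Lemma design_degree (P B : finType) (inc : P -> pred B) (k : nat) :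
  (forall b, #|[set p | inc p b]| = k) ->
  (forall p q, p != q -> #|[set b | inc p b && inc q b]| = 1%N) ->
  forall p, (#|[set b | inc p b]| * (k - 1) = #|P| - 1)%N.
Proof.
move=> size_b pair_b p.
transitivity (\sum_(q in [set~ p]) #|[set b | inc p b && inc q b]|)%N;
  last first.
  under eq_bigr => q; first by rewrite !inE eq_sym => /pair_b ->; over.
  by rewrite sum1_card cardsC1 subn1.
rewrite -sum_nat_const.
under [RHS]eq_bigr do rewrite card_set_sum.
rewrite exchange_big [LHS]big_mkcond; apply: eq_bigr => b _ /=.
rewrite inE; case: ifP => [pb|_]; last by rewrite big1.
rewrite -(size_b b) (cardsD1 p) inE pb addKn -sum1_card big_mkcond.
rewrite [RHS]big_mkcond; apply: eq_bigr => q _; rewrite !inE.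
by case: eqP => //=; case: inc.
Qed.

(** Count the incident pairs of a point and a block. *)
Lemma design_flags (P B : finType) (inc : P -> pred B) (k r : nat) :
  (forall b, #|[set p | inc p b]| = k) ->
  (forall p, #|[set b | inc p b]| = r) ->
  (#|B| * k = #|P| * r)%N.
Proof.
move=> size_b deg_p; rewrite -!sum_nat_const.
rewrite -(eq_bigr _ (fun b _ => size_b b)) -(eq_bigr _ (fun p _ => deg_p p)).
under eq_bigr do rewrite card_set_sum.
by rewrite exchange_big; apply: eq_bigr => p _; rewrite card_set_sum.
Qed.

(** Since M = v r / k, this is v <= r k. Multiplied by k - 1, it becomes
    v (k - 1) <= k (v - 1), that is, k <= v. *)
Lemma design_num_blocks_le (k v r M : nat) :
  (2 <= k)%N -> (k <= v)%N -> (r * (k - 1) = v - 1)%N -> (M * k = v * r)%N ->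
  (M <= r * r)%N.
Proof.
move=> k2 kv rk Mk.
have : (v * (k - 1) <= k * (v - 1))%N by nia.
rewrite -rk => vk.
have vrk : (v <= r * k)%N by rewrite -(@leq_pmul2r (k - 1)) ?subn_gt0 //; nia.
by rewrite -(@leq_pmul2r k) //; nia.
Qed.

(** Since M = v r / k, this is k (r + 1) <= 2 v, where
    2 v - k (r + 1) = (r - 1) (k - 2) because v = r (k - 1) + 1. *)
Lemma design_num_blocks_ge (k v r M : nat) :
  (2 <= k)%N -> (k <= v)%N -> (r * (k - 1) = v - 1)%N -> (M * k = v * r)%N ->
  (r * r.+1 <= 2 * M)%N.
Proof.
move=> k2 kv rk Mk.
have vrk : (k * r.+1 <= 2 * v)%N.
  have -> : v = (r * (k - 1) + 1)%N by lia.
  have r1 : (0 < r)%N by case: (r) rk => //; lia.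
  nia.
by rewrite -(@leq_pmul2r k) //; nia.
Qed.

(** Moves the axioms of a Steiner system from sets of points to the row and
    column indices of the incidence matrix. *)
Lemma steiner_incidence (k v M : nat) (V : finType) (blocks : {set {set V}})
    (pt : 'I_v -> V) (blk : 'I_M -> {set V}) :
  steiner_system k v blocks -> bijective pt -> injective blk ->
  [set blk b | b : 'I_M] = blocks ->
  (forall b, #|[set j | pt j \in blk b]| = k) /\
  (forall i j, i != j ->
     #|[set b | (pt i \in blk b) && (pt j \in blk b)]| = 1%N).
Proof.
move=> [_ _ _ size_b pair_b] pt_bij blk_inj blkE; split=> [b|i j ij].
  rewrite -(size_b (blk b)); last by rewrite -blkE imset_f.
  rewrite -(on_card_preimset (onW_bij _ pt_bij)).
  by apply: eq_card => j; rewrite !inE.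
rewrite -(pair_b [set pt i; pt j]); last first.
  by rewrite cards2 (inj_eq (bij_inj pt_bij)) ij.
rewrite -(card_imset _ blk_inj); apply: eq_card => B; rewrite inE -blkE.
apply/imsetP/andP => [[b + ->]|[/imsetP[b _ ->]]].
  by rewrite inE subUset !sub1set => ?; rewrite imset_f.
by rewrite subUset !sub1set => ?; exists b; rewrite // inE.
Qed.

(** * The columns attached to one point *)

(** The matrix Phi_j of the construction, before scaling: row b carries a row of
    H when block b contains the point, that is, when I b. *)
Definition spread (C : nzRingType) (n M : nat) (I : pred 'I_M) (H : 'M[C]_n)
    (sel : 'I_M -> 'I_n) : 'M[C]_(M, n) :=
  \matrix_(b, p) if I b then H (sel b) p else 0.

(** The rows of H are orthogonal of squared norm n, so H / n has the conjugate
    transpose of H as right inverse; it is also a left inverse, which says that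
    the columns are orthogonal. *)
Lemma unimodular_orthogonal_cols (R : realType) (n : nat) (H : 'M[R[i]]_n)
    (p q : 'I_n) :
  unimodular_orthogonal H -> p != q ->
  \sum_s H s p * Num.conj (H s q) = 0.
Proof.
move=> [uni orth] pq.
have n0 : n%:R != 0 :> R[i].
  by rewrite pnatr_eq0 -lt0n (leq_ltn_trans _ (ltn_ord p)).
have HH : (n%:R^-1 *: H) *m (map_mx Num.conj H)^T = 1%:M.
  apply/matrixP => i j; rewrite -scalemxAl !mxE.
  have [<-|ij] := eqVneq i j; last first.
    transitivity (n%:R^-1 * dotmx (row i H) (row j H)); last first.
      by rewrite orth // mulr0.
    by rewrite dotmxE mxE; congr (_ * _); apply: eq_bigr => l _; rewrite !mxE.
  under eq_bigr do rewrite !mxE -modulus_sqrE uni expr1n.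
  by rewrite sumr_const card_ord mulVf.
move/mulmx1C/matrixP/(_ q p): HH; rewrite !mxE eq_sym (negPf pq).
have -> : \sum_s (map_mx Num.conj H)^T q s * (n%:R^-1 *: H) s p =
    n%:R^-1 * \sum_s H s p * Num.conj (H s q).
  by rewrite mulr_sumr; apply: eq_bigr => s _; rewrite !mxE; ring.
by move/eqP; rewrite mulf_eq0 invr_eq0 (negPf n0) => /eqP.
Qed.

(** An injective selection of r among r + 1 rows leaves out exactly one, s0.
    A sum over the selected rows is then a full sum minus one term. *)
Lemma missing_row (M r : nat) (I : pred 'I_M) (sel : 'I_M -> 'I_(1 + r)) :
  #|[set b | I b]| = r -> {in [set b | I b] &, injective sel} ->
  exists2 s0, forall b, I b -> sel b != s0 &
    forall (C : zmodType) (F : 'I_(1 + r) -> C),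
      \sum_(b | I b) F (sel b) = (\sum_s F s) - F s0.
Proof.
move=> card_I sel_inj; set S := sel @: [set b | I b].
have /eqP/cards1P[s0 Cs0] : #|~: S| = 1%N.
  by rewrite cardsCs setCK card_ord card_in_imset // card_I addnK.
exists s0 => [b Ib|C F].
  have : s0 \in ~: S by rewrite Cs0 set11.
  by rewrite inE; apply: contraNneq => <-; apply: imset_f; rewrite inE.
rewrite (bigID (mem S)) /=.
have -> : \sum_(s | s \notin S) F s = F s0.
  transitivity (\sum_(s in [set s0]) F s); last by rewrite big_set1.
  by rewrite -Cs0; apply: eq_bigl => s; rewrite inE.
by rewrite addrK big_imset //=; apply: eq_bigl => b; rewrite inE.
Qed.

Lemma spread_col_norm (R : realType) (n M : nat) (I : pred 'I_M)
    (H : 'M[R[i]]_n) (sel : 'I_M -> 'I_n) (p : 'I_n) :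
  unimodular_orthogonal H ->
  \sum_b modulus (spread I H sel b p) ^+ 2 = #|[set b | I b]|%:R.
Proof.
move=> [uni _]; rewrite card_set_sum natr_sum; apply: eq_bigr => b _.
by rewrite mxE; case: (I b); rewrite ?uni ?expr1n // modulus0 expr0n.
Qed.

(** The full sum over the rows of H vanishes, so what remains is minus the term
    of the missing row. *)
Lemma spread_coherence_same (R : realType) (r M : nat) (I : pred 'I_M)
    (H : 'M[R[i]]_(1 + r)) (sel : 'I_M -> 'I_(1 + r)) (p q : 'I_(1 + r)) :
  unimodular_orthogonal H -> #|[set b | I b]| = r ->
  {in [set b | I b] &, injective sel} -> p != q ->
  modulus (\sum_b spread I H sel b p * Num.conj (spread I H sel b q)) = 1.
Proof.
move=> oH card_I sel_inj pq.
have [s0 _ sumI] := missing_row card_I sel_inj.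
have -> : \sum_b spread I H sel b p * Num.conj (spread I H sel b q) =
    \sum_(b | I b) H (sel b) p * Num.conj (H (sel b) q).
  rewrite [RHS]big_mkcond; apply: eq_bigr => b _; rewrite !mxE.
  by case: (I b); rewrite // mul0r.
rewrite (sumI _ (fun s => H s p * Num.conj (H s q))).
rewrite unimodular_orthogonal_cols // sub0r modulusN modulusM modulus_conj.
by case: oH => uni _; rewrite !uni mulr1.
Qed.

(** Only the unique block through both points contributes. *)
Lemma spread_coherence_diff (R : realType) (n M : nat) (I J : pred 'I_M)
    (G H : 'M[R[i]]_n) (sG sH : 'I_M -> 'I_n) (p q : 'I_n) :
  unimodular_orthogonal G -> unimodular_orthogonal H ->
  #|[set b | I b && J b]| = 1%N ->
  modulus (\sum_b spread I G sG b p * Num.conj (spread J H sH b q)) = 1.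
Proof.
move=> [uG _] [uH _] /eqP/cards1P[b0 IJ].
rewrite (bigD1 b0) //= big1 => [|b bb0].
  have : b0 \in [set b | I b && J b] by rewrite IJ set11.
  rewrite inE => /andP[Ib Jb]; rewrite addr0 !mxE Ib Jb.
  by rewrite modulusM modulus_conj uG uH mulr1.
have : b \notin [set b | I b && J b] by rewrite IJ inE.
rewrite inE !mxE.
by case: (I b); case: (J b); rewrite //= ?rmorph0 ?mul0r ?mulr0.
Qed.

(** The conjugate of the missing row is orthogonal to every selected row. *)
Lemma spread_kernel (R : realType) (r M : nat) (I : pred 'I_M)
    (H : 'M[R[i]]_(1 + r)) (sel : 'I_M -> 'I_(1 + r)) :
  unimodular_orthogonal H -> #|[set b | I b]| = r ->
  {in [set b | I b] &, injective sel} ->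
  exists2 y : 'cV_(1 + r), y != 0 & spread I H sel *m y = 0.
Proof.
move=> [uni orth] card_I sel_inj.
have [s0 miss _] := missing_row card_I sel_inj.
exists (\col_p Num.conj (H s0 p)).
  apply/cV0Pn; exists ord0.
  by rewrite mxE -modulus_eq0 modulus_conj uni oner_eq0.
apply/colP => b; rewrite !mxE; case Ib: (I b); last first.
  by rewrite big1 // => p _; rewrite !mxE Ib mul0r.
have := orth _ _ (miss b Ib); rewrite dotmxE !mxE => {2}<-.
by apply: eq_bigr => p _; rewrite !mxE Ib.
Qed.

(** * The whole frame *)

(** For blocks of constant width the position inside a block has a type that
    does not depend on the block, so a column index is determined by two plain
    ordinals, compared with Leibniz equality. *)
Lemma sig12_inj (v n : nat) (c c' : 'I_(\sum_(j < v) n)) :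
  tagnat.sig1 c = tagnat.sig1 c' ->
  tagnat.sig2 c = tagnat.sig2 c' :> 'I_n -> c = c'.
Proof.
move=> e1 e2; rewrite -(tagnat.sig2K c) -(tagnat.sig2K c').
apply: val_inj; apply/eqP; rewrite tagnat.eq_Rank (introT eqP e1) /=.
apply/eqP; exact: (congr1 (@nat_of_ord n) e2).
Qed.

Lemma mxrow_spread_coherence (R : realType) (v r M : nat)
    (inc : 'I_v -> pred 'I_M) (H : 'I_v -> 'M[R[i]]_(1 + r))
    (sel : 'I_v -> 'I_M -> 'I_(1 + r)) (a : R)
    (F := a%:C *: \mxrow_(j < v) spread (inc j) (H j) (sel j)) :
  (forall j, #|[set b | inc j b]| = r) ->
  (forall i j, i != j -> #|[set b | inc i b && inc j b]| = 1%N) ->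
  (forall j, unimodular_orthogonal (H j)) ->
  (forall j, {in [set b | inc j b] &, injective (sel j)}) ->
  (forall c, \sum_b modulus (F b c) ^+ 2 = a ^+ 2 * r%:R) /\
  (forall c c', c != c' ->
     modulus (\sum_b F b c * Num.conj (F b c')) = a ^+ 2).
Proof.
move=> deg pair uH sel_inj.
have FE b c : F b c = a%:C *
    spread (inc (tagnat.sig1 c)) (H (tagnat.sig1 c)) (sel (tagnat.sig1 c)) b
      (tagnat.sig2 c).
  by rewrite /F !mxE.
have a2 : modulus (a%:C * a%:C) = a ^+ 2.
  by rewrite -rmorphM modulus_real -expr2 ger0_norm ?sqr_ge0.
have col_norm j (p : 'I_(1 + r)) :
    \sum_b modulus (a%:C * spread (inc j) (H j) (sel j) b p) ^+ 2 =
    a ^+ 2 * r%:R.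
  rewrite -[in RHS](deg j) -(spread_col_norm (inc j) (sel j) p (uH j)).
  rewrite mulr_sumr; apply: eq_bigr => b _.
  by rewrite modulusM modulus_real exprMn real_normK ?num_real.
have cross i j (p q : 'I_(1 + r)) : (i == j -> p != q) ->
    modulus (\sum_b a%:C * spread (inc i) (H i) (sel i) b p *
      Num.conj (a%:C * spread (inc j) (H j) (sel j) b q)) = a ^+ 2.
  move=> pq.
  have -> : \sum_b a%:C * spread (inc i) (H i) (sel i) b p *
      Num.conj (a%:C * spread (inc j) (H j) (sel j) b q) =
    (a%:C * a%:C) * \sum_b spread (inc i) (H i) (sel i) b p *
      Num.conj (spread (inc j) (H j) (sel j) b q).
    rewrite mulr_sumr; apply: eq_bigr => b _; rewrite rmorphM /=.
    have -> : Num.conj a%:C = a%:C by apply/CrealP; rewrite complex_real.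
    by ring.
  rewrite modulusM a2; have [ij|ij] := eqVneq i j.
    subst j; rewrite spread_coherence_same ?mulr1 //; exact: pq.
  by rewrite spread_coherence_diff ?mulr1 //; exact: pair.
split=> [c|c c' cc'].
  rewrite -(col_norm (tagnat.sig1 c) (tagnat.sig2 c)).
  by apply: eq_bigr => b _; rewrite FE.
rewrite -(cross (tagnat.sig1 c) (tagnat.sig1 c')
  (tagnat.sig2 c) (tagnat.sig2 c')); last first.
  by move=> /eqP e; apply: contra_neq cc'; exact: sig12_inj.
by congr modulus; apply: eq_bigr => b _; rewrite !FE.
Qed.

(** Extend the kernel vector of one Phi_j by zero; its support has at most as
    many elements as Phi_j has columns. *)
Lemma mxrow_spread_kernel (R : realType) (v r M : nat)
    (inc : 'I_v -> pred 'I_M) (H : 'I_v -> 'M[R[i]]_(1 + r))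
    (sel : 'I_v -> 'I_M -> 'I_(1 + r)) (a : R) (j : 'I_v) :
  #|[set b | inc j b]| = r -> unimodular_orthogonal (H j) ->
  {in [set b | inc j b] &, injective (sel j)} ->
  exists x : 'cV[R[i]]_(\sum_(j < v) (1 + r)),
    [/\ x != 0, (#|[set c | x c 0%R != 0%R]| <= 1 + r)%N &
      (a%:C *: \mxrow_(j < v) spread (inc j) (H j) (sel j)) *m x = 0].
Proof.
move=> deg uH sel_inj; have [y y0 ker_y] := spread_kernel uH deg sel_inj.
exists (\mxcol_i (if i == j then y else 0)); split.
- apply: contra_neq y0 => x0.
  have := mxcolK (fun i => if i == j then y else 0) j.
  by rewrite x0 eqxx => <-; apply/colP => p; rewrite !mxE.
- pose f (c : 'I_(\sum_(j < v) (1 + r))) : 'I_(1 + r) := tagnat.sig2 c.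
  rewrite -[X in (_ <= X)%N]card_ord -(@card_in_imset _ _ f) ?max_card //.
  have sig1_supp c :
      c \in [set c | (\mxcol_i (if i == j then y else 0)) c 0 != 0] ->
      tagnat.sig1 c = j.
    by rewrite inE mxE; case: (tagnat.sig1 c =P j) => //= _; rewrite mxE eqxx.
  by move=> c c' /sig1_supp e /sig1_supp e'; apply: sig12_inj; rewrite e e'.
rewrite -scalemxAl mul_mxrow_mxcol big1 ?scaler0 // => i _.
by case: eqP => [->|_]; rewrite ?ker_y ?mulmx0.
Qed.

Theorem mainTheorem2 (R : realType) (M N : nat) (Phi : 'M[R[i]]_(M, N))
    (hPhi : steiner_etf Phi) :
  (forall delta : R, 0 < delta ->
     forall K : nat, (0 < K)%N -> K%:R <= delta * Num.sqrt (M%:R : R) ->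
       restricted_isometry Phi K delta)
  /\
  (forall epsilon : R, 0 < epsilon ->
     forall K : nat, Num.sqrt (2 * M%:R : R) < K%:R ->
       ~ restricted_isometry Phi K (1 - epsilon)).
Proof.
case: hPhi => k v V blocks pt blk H sel A eN.
move=> steiner _ pt_bij blk_inj blkE uH sel_inj PhiE; subst N.
have [size_b pair_b] := steiner_incidence steiner pt_bij blk_inj blkE.
have [k2 kv _ _ _] := steiner.
pose inc j := fun b : 'I_M => pt j \in blk b.
set r := replication k v in H sel uH sel_inj Phi PhiE *.
have degree j : (#|[set b | inc j b]| * (k - 1) = v - 1)%N.
  by have := design_degree size_b pair_b j; rewrite card_ord.
have deg j : #|[set b | inc j b]| = r.
  by rewrite /r /replication -(degree j) mulnK // subn_gt0.
(* From here on only the counting identities for r matter; as an opaque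
   number it is not unfolded into a quotient by field. *)
clearbody r.
have v0 : (0 < v)%N by lia.
have rk : (r * (k - 1) = v - 1)%N by rewrite -(deg (Ordinal v0)) degree.
have Mk : (M * k = v * r)%N.
  by have := design_flags size_b deg; rewrite !card_ord.
have r0 : (0 < r)%N by case: (posnP r) rk => // ->; lia.
have {}sel_inj j : {in [set b | inc j b] &, injective (sel j)}.
  move=> b b'; rewrite !inE => jb jb'; apply: sel_inj.
    by rewrite !mxE -/(inc j b) jb.
  by rewrite !mxE -/(inc j b') jb'.
have {}PhiE : Phi = (Num.sqrt (r%:R^-1 : R))%:C *:
    \mxrow_(j < v) spread (inc j) (H j) (sel j).
  rewrite PhiE castmx_id; congr (_%:C *: _).
    congr Num.sqrt.
    have -> : v%:R - 1 = r%:R * (k%:R - 1) :> R.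
      have k1 := ltnW k2; rewrite -[X in _ = _ * (_ - X)]/(1%:R) -natrB //.
      by rewrite -natrM rk natrB.
    by field; rewrite subr_eq0 !pnatr_eq1 pnatr_eq0; lia.
  apply/eq_mxrow => j; apply/matrixP => b p; rewrite !mxE /inc.
  by case: (pt j \in blk b); rewrite ?eqxx ?mxE // eq_sym oner_eq0 mxE.
have sqr_a : Num.sqrt (r%:R^-1 : R) ^+ 2 = r%:R^-1.
  by rewrite sqr_sqrtr // invr_ge0 ler0n.
split=> [delta d0 K K0 Kd|epsilon e0 K MK].
  have [cols coh] := mxrow_spread_coherence
    (Num.sqrt (r%:R^-1 : R)) deg pair_b uH sel_inj.
  rewrite PhiE; apply: (@coherence_restricted_isometry _ _ _ _ r%:R^-1).
  - by rewrite invr_ge0 ler0n.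
  - by move=> c; rewrite cols sqr_a mulVf // pnatr_eq0 -lt0n.
  - by move=> c c' cc'; rewrite coh // sqr_a.
  rewrite ler_pdivrMr ?ltr0n //.
  have sM : Num.sqrt (M%:R : R) <= r%:R.
    rewrite -[r%:R]ger0_norm ?ler0n // -sqrtr_sqr ler_sqrt ?sqr_ge0 //.
    by rewrite -natrX ler_nat expnS expn1 (design_num_blocks_le k2 kv rk Mk).
  have := ler_wpM2l (ltW d0) sM; lra.
have rK : (1 + r <= K)%N.
  rewrite add1n -(ltr_nat R) (le_lt_trans _ MK) //.
  rewrite -[r%:R]ger0_norm ?ler0n // -sqrtr_sqr ler_sqrt ?mulr_ge0 //.
  rewrite -natrX -natrM ler_nat expnS expn1.
  rewrite (leq_trans _ (design_num_blocks_ge k2 kv rk Mk)) //.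
  by rewrite leq_mul2l leqnSn orbT.
have [x [x0 supp_x ker_x]] := mxrow_spread_kernel
  (Num.sqrt (r%:R^-1 : R)) (deg (Ordinal v0)) (uH _) (sel_inj _).
apply: (sparse_kernel_not_restricted_isometry e0 x0).
  by rewrite PhiE.
exact: leq_trans supp_x rK.
Qed.
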